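(* Let $m,k\ge1$, $q=2^{km}$, $d=2^m$, $n=(q+1)(d-1)$, $N=(q-1)/(d-1)$, $r=q^2$, $\alpha$ a generator of $\mathrm{GF}(r)^*$, $\beta=\alpha^N$, $\mathrm{Tr}$ the trace from $\mathrm{GF}(r)$ to $\mathrm{GF}(q)$, $\mathbf{c}_a=(\mathrm{Tr}(a\beta^0),\dots,\mathrm{Tr}(a\beta^{n-1}))$, and $\widetilde{\mathcal{C}}=\{\mathbf{c}_a+b\mathbf{1}:a\in\mathrm{GF}(r),b\in\mathrm{GF}(q)\}$ with $\mathbf{1}$ the all-one vector of length $n$. Let $\overline{\mathcal{C}}$ be the extended code of $\widetilde{\mathcal{C}}$, obtained by appending to each codeword $(c_0,\dots,c_{n-1})$ the coordinate $-\sum_i c_i$. Then $\overline{\mathcal{C}}$ is an $[n+1,3,n+1-d]$ code over $\mathrm{GF}(q)$ whose only nonzero weights are $n+1-d$ and $n+1$, with weight enumerator $$1+\frac{(q^2-1)(n+1)}{d}z^{n+1-d}+\frac{(q^3-1)d-(q^2-1)(n+1)}{d}z^{n+1}.$$ Furthermore, the minimum distance of the dual code $\overline{\mathcal{C}}^\perp$ is $3$ when $m>1$ and $4$ when $m=1$. *)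

(* Defs.v *)
From mathcomp Require Import all_boot all_order all_algebra.
From mathcomp Require Import all_fingroup all_solvable all_field.

Set Implicit Arguments.
Unset Strict Implicit.
Unset Printing Implicit Defensive.

Import GRing.Theory.
Local Open Scope ring_scope.

Section Trace.

Variables (F : finFieldType) (L : fieldExtType F).

(* [galTrace] takes its values in L, inside the copy 1%VS of F; reading off the
   coordinate on the basis (1) gives the F-valued trace, see [traceE]. *)
Definition trace (x : finvect_type L) : F :=
  coord [tuple (1 : L)] ord0 (galTrace 1%VS {:finvect_type L}%VS x : L).

Lemma traceE (x : finvect_type L) :
  (trace x)%:A = galTrace 1%VS {:finvect_type L}%VS x.
Proof.
have gal : galois (1%AS : {subfield finvect_type L}) {:finvect_type L}%AS.
  exact: finField_galois (sub1v _).
have x1 : galTrace 1%VS {:finvect_type L}%VS x \in (1%AS : {subfield finvect_type L}).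
  by apply: mem_galTrace gal (memvf x).
have [c xc] := vlineP _ _ x1.
have x1' : (galTrace 1%VS {:finvect_type L}%VS x : L) \in <<[tuple (1%R : L)]>>%VS.
  by rewrite span_seq1 xc; apply/vlineP; exists c.
by rewrite [RHS](coord_span x1') big_ord1.
Qed.

End Trace.

Section Codes.

Variable F : finFieldType.

Definition weight n (x : 'rV[F]_n) : nat := #|[set i | x 0 i != 0]|.

Definition hdist n (x y : 'rV[F]_n) : nat := #|[set i | x 0 i != y 0 i]|.

Definition min_distance n (C : {set 'rV[F]_n}) (dmin : nat) : Prop :=
  (exists x y, [/\ x \in C, y \in C, x != y & hdist x y = dmin]) /\
  (forall x y, x \in C -> y \in C -> x != y -> (dmin <= hdist x y)%N).

(* C is an [n, kappa, dmin] code over F. *)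
Definition linear_code n (C : {set 'rV[F]_n}) (kappa dmin : nat) : Prop :=
  (exists V : {vspace 'rV[F]_n}, C =i V /\ \dim V = kappa) /\
  min_distance C dmin.

Definition weight_enumerator n (C : {set 'rV[F]_n}) : {poly rat} :=
  \sum_(w < n.+1) #|[set c in C | weight c == w]|%:R *: 'X^w.

Definition dual_code n (C : {set 'rV[F]_n}) : {set 'rV[F]_n} :=
  [set y : 'rV[F]_n | [forall x in C, \sum_i x 0 i * y 0 i == 0]].

Definition extend_word n (c : 'rV[F]_n) : 'rV[F]_(n + 1) :=
  row_mx c (const_mx (- \sum_i c 0 i)).

Definition extended_code n (C : {set 'rV[F]_n}) : {set 'rV[F]_(n + 1)} :=
  [set extend_word c | c in C].

Variable L : fieldExtType F.

Definition trace_word n (beta a : finvect_type L) : 'rV[F]_n :=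
  \row_(i < n) trace (a * beta ^+ i).

Definition augmented_trace_code n (beta : finvect_type L) : {set 'rV[F]_n} :=
  [set trace_word n beta a + b *: const_mx 1 | a : finvect_type L, b : F].

End Codes.

(* Main.v *)
(** The codewords of the extended code are the value vectors of the affine
    functions x |-> Tr(a x) + b on the set S = {x : x^(n+1) = x}, i.e. 0 together
    with the powers of beta, the appended coordinate being the value at 0. Since
    n = (q+1)(d-1), S consists of the x whose norm x^(q+1) lies in GF(d): it is a
    Denniston maximal arc, and every affine line Tr(a x) = b over GF(q) that
    meets S does so in exactly d points. Indeed, after scaling, the points in
    question are the y with y^q + y = b and y (y + b) in G, for some additive
    subgroup G of GF(q) of order d; when b <> 0 the map y |-> y (y + b) is
    two-to-one, so the solutions of y (y + b) in G number 2d, and translation by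
    one point of the line exchanges those of trace b with those of trace 0.
    Hence the weights are n+1-d and n+1, and each a <> 0 has (n+1)/d lines
    meeting S. Dually, no two points of S support a dual word, and for d = 2 no
    three do, as the line through two of them misses the third; three collinear
    points of S (for d > 2) and any four points carry one by the pigeonhole
    principle. *)
Require Import Defs.
From mathcomp Require Import all_boot all_order all_algebra.
From mathcomp Require Import all_fingroup all_solvable all_field.
From mathcomp Require Import ring.

Set Implicit Arguments.
Unset Strict Implicit.
Unset Printing Implicit Defensive.

Import GRing.Theory.
Local Open Scope ring_scope.

(** * Roots of unity and uniform fibres *)

Lemma generator_prim_root (E : finFieldType) (a : {unit E}) :
  generator [set: {unit E}] a -> #|E|.-1.-primitive_root (FinRing.uval a).
Proof.
move=> /eqP genE; have oa : #[a]%g = #|E|.-1.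
  by rewrite -card_finField_unit genE.
have a1 : FinRing.uval a ^+ #|E|.-1 = 1.
  by rewrite -FinRing.val_unitX -oa expg_order.
have [|l la ldvd] := prim_order_exists _ a1.
  by rewrite -oa order_gt0.
suff /eqP <- : l == #|E|.-1 by [].
rewrite eqn_dvd ldvd -oa order_dvdn /= -val_eqE /= FinRing.val_unitX.
by rewrite (prim_expr_order la).
Qed.

(** The equation factors as x (x^e - 1) = 0, so its roots are 0 and the [e] powers of [w]. *)
Lemma card_expr_fix (E : finFieldType) (e : nat) (w : E) :
  e.-primitive_root w -> #|[set x : E | x ^+ e.+1 == x]| = e.+1.
Proof.
move=> we; have e_gt0 := prim_order_gt0 we.
have w_neq0 : w != 0.
  apply: contra_eq_neq (prim_expr_order we) => ->.
  by rewrite expr0n gtn_eqF // eq_sym oner_neq0.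
have -> : [set x : E | x ^+ e.+1 == x] = 0 |: [set w ^+ (i : 'I_e) | i in 'I_e].
  apply/setP=> x; rewrite !inE exprS -subr_eq0 -[X in _ - X]mulr1 -mulrBr mulf_eq0.
  rewrite subr_eq0; congr (_ || _); apply/eqP/imsetP => [/(prim_rootP we)[i ->]|[i _ ->]].
    by exists i.
  by rewrite exprAC (prim_expr_order we) expr1n.
rewrite cardsU1 card_imset ?card_ord.
  case: imsetP => // -[i _ /esym/eqP]; by rewrite expf_eq0 (negbTE w_neq0) andbF.
by move=> i j /eqP; rewrite (eq_prim_root_expr we) !modn_small // => /eqP/val_inj.
Qed.

Lemma card_expr_fix_dvdn (E : finFieldType) (e : nat) :
  (e %| #|E|.-1)%N -> #|[set x : E | x ^+ e.+1 == x]| = e.+1.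
Proof.
have /cyclicP[a aE] := field_unit_group_cyclic [set: {unit E}].
move=> e_dvd; have ga : generator [set: {unit E}] a by apply/eqP.
exact: card_expr_fix (dvdn_prim_root (generator_prim_root ga) e_dvd).
Qed.

Lemma card_preimset_uniform (T T' : finType) (f : T -> T') (A : {set T'}) (l : nat) :
  {in A, forall y, #|[set x | f x == y]| = l} ->
  #|[set x | f x \in A]| = (#|A| * l)%N.
Proof.
move=> fibers; rewrite -sum1_card (partition_big f [in A]) /=; last first.
  by move=> x; rewrite inE.
rewrite -sum_nat_const; apply: eq_bigr => y yA; rewrite -(fibers _ yA) -sum1_card.
by apply: eq_bigl => x; rewrite !inE; case: eqP => [->|]; rewrite ?yA ?andbF.
Qed.

(** * Lines of the affine plane GF(q^2) that meet the maximal arc *)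

Section LinesMeetingArc.

Variables (E : finFieldType) (q d : nat).
Hypotheses (E2 : 2%N \in [pchar E]) (cardE : #|E| = (q ^ 2)%N).
Hypotheses (q_pchar : [pchar E].-nat q) (d_pchar : [pchar E].-nat d).
Hypotheses (d_gt1 : (1 < d)%N) (dvd_dq : (d.-1 %| q.-1)%N).

Let q_gt0 : (0 < q)%N. Proof. by case/andP: q_pchar. Qed.
Let d_gt0 : (0 < d)%N. Proof. exact: ltnW. Qed.

Lemma frobenius_involutive : involutive (fun x : E => x ^+ q).
Proof. by move=> x; rewrite -exprM mulnn -cardE expf_card. Qed.

Lemma card_fix_frobenius : #|[set x : E | x ^+ q == x]| = q.
Proof.
rewrite -{1}(prednK q_gt0) card_expr_fix_dvdn ?prednK //.
by rewrite cardE dvdn_pred_predX.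
Qed.

Lemma card_fix_subfield : #|[set x : E | x ^+ d == x]| = d.
Proof.
rewrite -{1}(prednK d_gt0) card_expr_fix_dvdn ?prednK //.
by rewrite cardE (dvdn_trans dvd_dq) ?dvdn_pred_predX.
Qed.

(** This places GF(d) inside GF(q): a nonzero x has x^(d-1) = 1, and d - 1 divides q - 1. *)
Lemma subfield_fix_frobenius (x : E) : x ^+ d = x -> x ^+ q = x.
Proof.
have [->|x_neq0] := eqVneq x 0; first by rewrite !expr0n !gtn_eqF.
rewrite -{1}(prednK d_gt0) -{1}(prednK q_gt0) !exprS => xd.
have {}xd : x ^+ d.-1 = 1 by apply: (mulfI x_neq0); rewrite xd mulr1.
by case/dvdnP: dvd_dq => l ->; rewrite mulnC exprM xd expr1n mulr1.
Qed.

(** The trace from GF(q^2) to GF(q) as a polynomial map with values in [E], which keeps this part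
    free of Galois theory; [trace_tr] makes the link with [trace]. *)
Definition tr (x : E) : E := x ^+ q + x.

Lemma trD : {morph tr : x y / x + y}.
Proof. by move=> x y; rewrite /tr exprDn_pchar // addrACA. Qed.

Lemma tr_fix_frobenius (x : E) : tr x ^+ q = tr x.
Proof. by rewrite /tr exprDn_pchar // frobenius_involutive addrC. Qed.

Lemma tr_eq0 (x : E) : (tr x == 0) = (x ^+ q == x).
Proof. by rewrite /tr -GRing.subr_pchar2 // subr_eq0. Qed.

Lemma frobenius_tr (x : E) : x ^+ q = x + tr x.
Proof. by rewrite /tr addrCA addrr_pchar2 // addr0. Qed.

(** The fibre is a translate of the kernel, and the kernel is GF(q) because x^q + x = 0 means x^q =
    x in characteristic 2. *)
Lemma card_tr_fiber (y : E) : #|[set x | tr x == tr y]| = q.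
Proof.
rewrite -[RHS]card_fix_frobenius -[RHS](card_imset _ (addIr y)).
apply: eq_card => x; apply/idP/imsetP => [|[z]]; rewrite !inE.
  move=> /eqP xy; exists (x + y); last by rewrite -addrA addrr_pchar2 // addr0.
  by rewrite inE -tr_eq0 trD xy addrr_pchar2.
by rewrite -tr_eq0 => /eqP tr0 ->; rewrite trD tr0 add0r eqxx.
Qed.

(** The difference of the two sides is (x - y)(x - (y + b)) up to a multiple of 2. *)
Lemma quad_eq (b x y : E) : (x * (x + b) == y * (y + b)) = (x \in [set y; y + b]).
Proof.
rewrite -subr_eq0 !inE -[x == y]subr_eq0 -[x == y + b]subr_eq0 -mulf_eq0.
rewrite (_ : x * _ - _ = (x - y) * (x - (y + b)) + (x - y) * (y + b + (y + b))); last by ring.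
by rewrite addrr_pchar2 // mulr0 addr0.
Qed.

Lemma card_quad_fiber (b y : E) :
  b != 0 -> #|[set x | x * (x + b) == y * (y + b)]| = 2.
Proof.
move=> b_neq0; have -> : [set x | x * (x + b) == y * (y + b)] = [set y; y + b].
  by apply/setP=> x; rewrite inE quad_eq.
by rewrite cards2 -[X in X == _]addr0 (inj_eq (addrI y)) eq_sym b_neq0.
Qed.

(* The elements of trace 0 or b form the preimage of their image under
   y |-> y (y + b); that image lies in GF(q) and, the map being two-to-one, it
   has q elements. *)
Lemma quad_onto (b y0 z : E) :
  b != 0 -> tr y0 = b -> z ^+ q = z -> exists y, z = y * (y + b).
Proof.
move=> b_neq0 try0 zq; have bq : b ^+ q = b by rewrite -try0 tr_fix_frobenius.
pose f y := y * (y + b); pose W := [set y | tr y == 0] :|: [set y | tr y == b].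
have trb : tr b = 0 by apply/eqP; rewrite tr_eq0 bq.
have tr00 : tr 0 = 0 by apply/eqP; rewrite tr_eq0 expr0n gtn_eqF.
have cardW : #|W| = (q * 2)%N.
  rewrite /W -tr00 -try0 cardsU !card_tr_fiber tr00 try0 muln2 addnn.
  rewrite (_ : _ :&: _ = set0) ?cards0 ?subn0 //.
  apply/setP=> x; rewrite !inE; case: eqP => // ->.
  by rewrite eq_sym (negbTE b_neq0).
(* [W] is a union of fibres: they are the pairs y, y + b, and b has trace 0. *)
have WE : W = [set y | f y \in f @: W].
  apply/setP=> y; rewrite [in RHS]inE; apply/idP/imsetP => [yW|[x xW /eqP]].
    by exists y.
  by rewrite quad_eq !inE => /orP[] /eqP ->; move: xW; rewrite !inE // trD trb addr0.
(* The q-th power map fixes y or sends it to y + b; in the second case it swaps the two factors of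
   [f y]. *)
have fWq : f @: W \subset [set x | x ^+ q == x].
  apply/subsetP=> _ /imsetP[y yW ->]; rewrite inE /f exprMn.
  rewrite exprDn_pchar // bq frobenius_tr.
  move: yW; rewrite !inE => /orP[] /eqP ->; first by rewrite addr0.
  by rewrite -addrA addrr_pchar2 // addr0 mulrC.
suff /eqP fWE : f @: W == [set x | x ^+ q == x].
  have : z \in f @: W by rewrite fWE inE zq.
  by case/imsetP=> y _ ->; exists y.
rewrite eqEcard fWq /= card_fix_frobenius -(leq_pmul2r (isT : 0 < 2)%N) -cardW {1}WE.
rewrite (@card_preimset_uniform _ _ f (f @: W) 2) // => _ /imsetP[y _ ->].
exact: card_quad_fiber.
Qed.

(** An element y of trace b has y^q = y + b, so y (y + b) is its norm y^(q+1): the points counted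
    are those of a line whose norm lies in the additive group [G]. *)
Lemma card_line_meet (b y0 : E) (G : {set E}) :
    #|G| = d -> {in G, forall g, g ^+ q = g} -> {in G &, forall g h, g + h \in G} ->
    tr y0 = b -> y0 * (y0 + b) \in G ->
  #|[set y | (tr y == b) && (y * (y + b) \in G)]| = d.
Proof.
move=> cardG G_fix GD try0 y0G; have bq : b ^+ q = b by rewrite -try0 tr_fix_frobenius.
have [b0|b_neq0] := eqVneq b 0.
  rewrite b0; under eq_finset do rewrite addr0.
  have sqI : injective (fun x : E => x * x).
    move=> x y /eqP; have := quad_eq 0 x y; rewrite !addr0 => ->.
    by rewrite !inE orbb => /eqP.
  (* For b = 0 the trace condition is automatic: if y^2 is in GF(q) then so is y, squaring being
     injective. *)
  transitivity #|[set y | y * y \in G]|.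
    apply: eq_card => y; rewrite !inE tr_eq0.
    case: (boolP (y * y \in G)) => [/G_fix|_]; last by rewrite andbF.
    by rewrite andbT exprMn => /sqI ->; rewrite eqxx.
  rewrite (@card_preimset_uniform _ _ (fun y : E => y * y) G 1) ?cardG ?muln1 //.
  move=> z _; have /codomP[x ->] := injF_onto sqI z.
  rewrite (_ : [set _ | _] = [set x]) ?cards1 //.
  by apply/setP=> y; rewrite !inE (inj_eq sqI).
set P := [set y | _]; pose K := [set y | (tr y == 0) && (y * (y + b) \in G)].
have PK : #|P| = #|K|.
  rewrite -[RHS](card_imset _ (addIr y0)).
  (* The map y |-> y (y + b) is additive up to 2xy, so adding [y0] exchanges [P] and [K]. *)
  have quadD x y : (x + y) * (x + y + b) = x * (x + b) + y * (y + b).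
    by rewrite -[RHS]addr0 -(addrr_pchar2 E2 (x * y)); ring.
  apply: eq_card => y; apply/idP/imsetP => [|[z]]; rewrite !inE.
    move=> /andP[/eqP tryb yG]; exists (y + y0); last by rewrite -addrA addrr_pchar2 // addr0.
    by rewrite inE trD tryb try0 addrr_pchar2 // eqxx quadD GD.
  move=> /andP[/eqP trz zG] ->.
  by rewrite trD trz try0 add0r eqxx quadD GD.
(* If y (y + b) is in [G], it is fixed by the q-th power map, so y^q is y or y + b and y has trace 0
   or b. Thus the union is the full preimage of [G], all of whose fibres have two elements. *)
have PUK : #|P :|: K| = (d * 2)%N.
  rewrite -cardG -(@card_preimset_uniform _ _ (fun y => y * (y + b)) G 2).
    apply: eq_card => y; rewrite !inE -andb_orl.
    case: (boolP (y * (y + b) \in G)) => [/G_fix|_]; last by rewrite andbF.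
    rewrite andbT exprMn exprDn_pchar // bq => /eqP; rewrite quad_eq frobenius_tr !inE.
    by rewrite -[X in _ == X]addr0 !(inj_eq (addrI y)) orbC => ->.
  by move=> z /G_fix /(quad_onto b_neq0 try0)[y ->]; exact: card_quad_fiber.
apply/eqP; rewrite -(eqn_pmul2r (isT : 0 < 2)%N) -PUK cardsU -PK.
rewrite (_ : P :&: K = set0) ?cards0 ?subn0 ?muln2 ?addnn //.
apply/setP=> x; rewrite !inE; case: eqP => //= ->.
by rewrite (negbTE b_neq0) andbF.
Qed.

(** The substitution y = a x reduces the count to [card_line_meet]: it multiplies norms by the norm
    [c] of [a]. *)
Lemma card_line_arc (a b x0 : E) : a != 0 ->
    x0 ^+ ((q + 1) * (d - 1) + 1) = x0 -> tr (a * x0) = b ->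
  #|[set x | (x ^+ ((q + 1) * (d - 1) + 1) == x) && (tr (a * x) == b)]| = d.
Proof.
move=> a_neq0 x0S trx0; have bq : b ^+ q = b by rewrite -trx0 tr_fix_frobenius.
pose c := a ^+ (q + 1); have c_neq0 : c != 0 by rewrite expf_neq0.
have cq : c ^+ q = c.
  by rewrite /c exprD expr1 exprMn frobenius_involutive mulrC.
(* [G] is c GF(d), an additive subgroup of GF(q) of order [d]. *)
pose G := [set g : E | (g / c) ^+ d == g / c].
(* For nonzero x both sides say that x^((q+1)(d-1)) = 1, that is, the norm of x lies in GF(d). *)
have arcE (x : E) :
    (x ^+ ((q + 1) * (d - 1) + 1) == x) = ((x ^+ (q + 1)) ^+ d == x ^+ (q + 1)).
  have [->|x_neq0] := eqVneq x 0; first by rewrite !addn1 !exprS !mul0r expr0n gtn_eqF ?eqxx.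
  rewrite [X in _ ^+ X == _]addnC exprD exprM subn1 expr1.
  rewrite -[X in _ = (_ ^+ X == _)](prednK d_gt0) [in RHS]exprS.
  rewrite -[X in _ == X]mulr1 -[X in _ = (_ == X)]mulr1.
  by rewrite (inj_eq (mulfI x_neq0)) (inj_eq (mulfI (expf_neq0 _ x_neq0))).
have lineE (x : E) : tr (a * x) = b ->
    (x ^+ ((q + 1) * (d - 1) + 1) == x) = (a * x * (a * x + b) \in G).
  move=> <-; rewrite -frobenius_tr -exprS -(addn1 q) inE arcE [(a * x) ^+ _]exprMn -/c.
  by rewrite (mulrC c) mulfK.
have cardG : #|G| = d.
  rewrite -[RHS]card_fix_subfield -[RHS](card_imset _ (mulfI c_neq0)).
  apply: eq_card => x; apply/idP/imsetP => [|[z]]; rewrite !inE.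
    by move=> xG; exists (x / c); rewrite ?inE // mulrCA mulfV // mulr1.
  by move=> zd ->; rewrite [c * z]mulrC mulfK.
have G_fix : {in G, forall g, g ^+ q = g}.
  move=> g; rewrite inE => /eqP/subfield_fix_frobenius.
  by rewrite exprMn exprVn cq => /(mulIf (invr_neq0 c_neq0)).
have GD : {in G &, forall g h, g + h \in G}.
  by move=> g h; rewrite !inE mulrDl exprDn_pchar // => /eqP -> /eqP ->.
clearbody G; rewrite -[RHS](card_line_meet cardG G_fix GD trx0) -?lineE ?x0S //.
rewrite -[LHS](card_imset _ (mulfI a_neq0)); apply: eq_card => y.
apply/imsetP/idP => [[x + ->]|]; rewrite !inE.
  by move=> /andP[xS /eqP xb]; rewrite xb eqxx -lineE.
move=> /andP[/eqP yb yG].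
have ya : a * (y / a) = y by rewrite mulrCA mulfV // mulr1.
by exists (y / a); rewrite // inE lineE ya ?yb ?eqxx ?andbT.
Qed.

End LinesMeetingArc.

(** * The trace of the quadratic extension in characteristic 2 *)

Section QuadraticTrace.

Variables (e : nat) (F : finFieldType) (L : fieldExtType F).
Local Notation E := (finvect_type L).
Hypotheses (cardF : #|F| = (2 ^ e)%N) (cardE : #|E| = (#|F| ^ 2)%N).

Lemma trace_base_pchar2 : 2%N \in [pchar F].
Proof. exact: card_finPcharP cardF _. Qed.

Lemma trace_ext_pchar2 : 2%N \in [pchar E].
Proof. by rewrite (fmorph_pchar (in_alg E)) trace_base_pchar2. Qed.

Lemma ext_pchar_pow2 j : [pchar E].-nat (2 ^ j)%N.
Proof.
by rewrite (eq_pnat _ (pcharf_eq trace_ext_pchar2)) pnatX pnat_id ?orbT.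
Qed.

(** The extension has degree 2 by cardinality, so its Galois group consists of the identity and the
    Frobenius map x |-> x^q. *)
Lemma trace_tr (x : E) : (trace x)%:A = tr #|F| x.
Proof.
rewrite traceE /galTrace.
have [g gen_g gE] := finField_galois_generator (sub1v {:E}%AS).
have gal : galois (1%AS : {subfield E}) {:E}%AS by exact: finField_galois (sub1v _).
have dimE : \dim {:E} = 2.
  apply: (@expnI #|F|); first exact: finNzRing_gt1.
  by rewrite -card_vspace card_vspacef.
have galE := eqP gen_g; have := galois_dim gal; rewrite dimv1 divn1 dimE galE => og.
have g_neq1 : 1%g != g by apply: contra_eq_neq og => <-; rewrite cycle1 cards1.
have -> : <[g]>%g = [set 1%g; g].
  apply/eqP; rewrite eq_sym eqEcard subUset !sub1set group1 cycle_id -og.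
  by rewrite cards2 g_neq1.
rewrite big_setU1 ?big_set1 ?inE //=.
by rewrite gal_id gE ?memvf // dimv1 expn1 /tr addrC.
Qed.

Lemma trace_eq (x y : E) : (trace x == trace y) = (tr #|F| x == tr #|F| y).
Proof. by rewrite -!trace_tr (inj_eq (fmorph_inj (in_alg E))). Qed.

Lemma traceD : {morph @trace F L : x y / x + y}.
Proof.
move=> x y; apply: (fmorph_inj (in_alg E)); rewrite rmorphD /= !trace_tr.
by rewrite trD // cardF ext_pchar_pow2.
Qed.

Lemma traceZ (c : F) (x : E) : trace (c *: x) = c * trace x.
Proof.
apply: (fmorph_inj (in_alg E)); rewrite rmorphM /= !trace_tr.
by rewrite /tr exprZn expf_card -scalerDr mulr_algl.
Qed.

(** If z were nonzero, every x would be of the form a z and have trace 0; the q-th power map would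
    then fix all q^2 elements, whereas it fixes only q. *)
Lemma trace_nondegenerate (z : E) : (forall a, trace (a * z) = 0) -> z = 0.
Proof.
move=> trz; apply: contraTeq (finNzRing_gt1 F) => z_neq0; rewrite -leqNgt.
have /eqP : #|[set x : E | x ^+ #|F| == x]| = #|E|.
  apply: eq_card => x; rewrite inE -tr_eq0 ?trace_ext_pchar2 //.
  by rewrite -trace_tr -[x](mulfVK z_neq0) trz scale0r eqxx.
rewrite card_fix_frobenius ?cardE //; last by rewrite cardF ext_pchar_pow2.
by case: (leqP #|F| 1) => // F1; rewrite -{1}[#|F|]expn1 eqn_exp2l.
Qed.

Lemma trace1 : trace (1 : E) = 0.
Proof.
apply: (fmorph_inj (in_alg E)); rewrite rmorph0 /= trace_tr /tr expr1n.
exact: addrr_pchar2 trace_ext_pchar2 _.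
Qed.

End QuadraticTrace.

(** * Weights and distances in linear sets of words *)

Section LinearSets.

Variables (F : finFieldType) (n : nat).
Implicit Types (C : {set 'rV[F]_n}) (x y c : 'rV[F]_n).

Lemma hdistE x y : hdist x y = weight (x - y).
Proof. by apply: eq_card => i; rewrite !inE !mxE subr_eq0. Qed.

Lemma min_distance_weight C (dmin : nat) :
    {in C &, forall x y, x - y \in C} ->
    (exists c, [/\ c \in C, c != 0 & weight c = dmin]) ->
    {in C, forall c, c != 0 -> (dmin <= weight c)%N} ->
  min_distance C dmin.
Proof.
move=> CB [c [cC c_neq0 wc]] minC; split.
  exists c, 0; rewrite hdistE subr0; split=> //.
  by rewrite -(subrr c) CB.
by move=> x y xC yC xy; rewrite hdistE minC ?CB // subr_eq0.
Qed.

Lemma set_vspace C :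
    0 \in C -> {in C &, forall x y, x + y \in C} ->
    (forall a, {in C, forall x, a *: x \in C}) ->
  exists V : {vspace 'rV[F]_n}, C =i V.
Proof.
move=> C0 CD CZ; exists <<enum C>>%VS => x; apply/idP/idP => [xC|].
  by rewrite memv_span // mem_enum.
move=> /(@coord_span _ _ _ (in_tuple (enum C))) ->.
apply: (big_ind [in C]) => // i _; apply: CZ.
by rewrite -mem_enum mem_nth.
Qed.

Lemma weight_enumeratorE C :
  weight_enumerator C = \sum_(c in C) 'X^(weight c).
Proof.
have weight_le c : (weight c < n.+1)%N.
  by rewrite ltnS (leq_trans (max_card _)) ?card_ord.
rewrite (partition_big (fun c => Ordinal (weight_le c)) predT) //=.
apply: eq_bigr => w _; rewrite (eq_bigr (fun=> 'X^w)) => [|c /andP[_ /eqP <-] //].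
rewrite sumr_const scaler_nat; congr (_ *+ _).
by apply: eq_card => c; rewrite !inE.
Qed.

End LinearSets.

Lemma exists_subset_card (T : finType) (B : {set T}) (j : nat) :
  (j <= #|B|)%N -> exists2 A : {set T}, A \subset B & #|A| = j.
Proof.
rewrite -bin_gt0 -cards_draws card_gt0 => /set0Pn[A].
by rewrite inE => /andP[AB /eqP]; exists A.
Qed.

(** * Affine functions on a point set that every line meets in 0 or d points *)

Section PointCode.

Variables (e : nat) (F : finFieldType) (L : fieldExtType F).
Local Notation E := (finvect_type L).
Hypotheses (cardF : #|F| = (2 ^ e)%N) (cardE : #|E| = (#|F| ^ 2)%N).
Variables (l d : nat) (pt : 'I_l -> E) (o : 'I_l).
Hypotheses (pt_inj : injective pt) (pt_o : pt o = 0) (d_lt : (d < l)%N).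
Hypothesis card_line : forall (a : E) (i0 : 'I_l), a != 0 ->
  #|[set i | trace (a * pt i) == trace (a * pt i0)]| = d.

Definition point_word (a : E) (b : F) : 'rV[F]_l := \row_i (trace (a * pt i) + b).

Definition point_code : {set 'rV[F]_l} := [set point_word p.1 p.2 | p : E * F].

Let trD := traceD cardF cardE.
Let trZ := traceZ cardE.

Let tr0 : trace (0 : E) = 0.
Proof. by rewrite -(scale0r 0) trZ mul0r. Qed.

Let trN x : trace (- x : E) = - trace x.
Proof. by rewrite -scaleN1r trZ mulN1r. Qed.

Let d_gt0 : (0 < d)%N.
Proof.
by rewrite -(card_line o (oner_neq0 E)) card_gt0; apply/set0Pn; exists o; rewrite inE.
Qed.

Lemma point_wordB a b a' b' :
  point_word a b - point_word a' b' = point_word (a - a') (b - b').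
Proof. by apply/rowP=> i; rewrite !mxE mulrBl trD trN opprD addrACA. Qed.

Lemma point_wordZ c a b : c *: point_word a b = point_word (c *: a) (c * b).
Proof. by apply/rowP=> i; rewrite !mxE -scalerAl trZ mulrDr. Qed.

Lemma mem_point_code a b : point_word a b \in point_code.
Proof. by apply/imsetP; exists (a, b). Qed.

Lemma weight_point_word_const (b : F) : b != 0 -> weight (point_word 0 b) = l.
Proof.
move=> b_neq0; rewrite -[RHS]card_ord -cardsT; apply: eq_card => i.
by rewrite !inE mxE mul0r tr0 add0r b_neq0.
Qed.

Lemma weight_point_word_compl a b :
  (weight (point_word a b) + #|[set i | (trace (a * pt i) == - b)%R]|)%N = l.
Proof.
rewrite -[RHS]card_ord -(cardsC [set i | trace (a * pt i) == - b]) addnC.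
by congr (_ + _)%N; apply: eq_card => i; rewrite !inE mxE addr_eq0.
Qed.

Lemma weight_point_word_meet a i0 :
  a != 0 -> weight (point_word a (- trace (a * pt i0))) = (l - d)%N.
Proof.
move=> a_neq0; rewrite -[in RHS](weight_point_word_compl a (- trace (a * pt i0))).
by rewrite opprK card_line // addnK.
Qed.

Lemma weight_point_word a b : a != 0 ->
  weight (point_word a b) =
    if b \in [set - trace (a * pt i) | i : 'I_l] then (l - d)%N else l.
Proof.
move=> a_neq0; case: imsetP => [[i _ ->]|miss]; first exact: weight_point_word_meet.
rewrite -[RHS](weight_point_word_compl a b) (_ : [set _ | _] = set0) ?cards0 ?addn0 //.
apply/setP=> i; rewrite !inE; apply/eqP => tri; case: miss; exists i => //.
by rewrite tri opprK.
Qed.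

(** The lines of direction [a] that meet the point set partition its [l] points into classes of size
    [d]. *)
Lemma card_meeting_lines a : a != 0 ->
  (#|[set (- trace (a * pt i))%R | i : 'I_l]| * d)%N = l.
Proof.
move=> a_neq0; rewrite -(@card_preimset_uniform _ _ (fun i => - trace (a * pt i))).
  rewrite -[RHS]card_ord -cardsT; apply: eq_card => i.
  by rewrite !inE (imset_f (fun i => - trace (a * pt i))) ?inE.
move=> _ /imsetP[i0 _ ->]; rewrite -[RHS](card_line i0 a_neq0).
by apply: eq_card => i; rewrite !inE eqr_opp.
Qed.

(** A nonzero affine function has weight [l] or [l - d], both positive. This makes the
    parametrization by (a, b) injective. *)
Lemma point_word_eq0 a b : (point_word a b == 0) = ((a, b) == (0, 0)).
Proof.
apply/eqP/eqP => [w0|[-> ->]]; last by apply/rowP=> i; rewrite !mxE mul0r tr0 add0r.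
have /eqP : weight (point_word a b) = 0%N.
  by rewrite w0; apply: eq_card0 => i; rewrite !inE mxE eqxx.
have l_gt0 : (0 < l)%N by apply: leq_ltn_trans d_lt.
have [->|a_neq0] := eqVneq a 0.
  by have [->|/weight_point_word_const ->] := eqVneq b 0; rewrite ?(gtn_eqF l_gt0).
by rewrite weight_point_word //; case: ifP; rewrite gtn_eqF ?subn_gt0.
Qed.

Lemma point_word_inj : injective (fun p : E * F => point_word p.1 p.2).
Proof.
move=> [a b] [a' b'] /= /eqP; rewrite -subr_eq0 point_wordB point_word_eq0.
by move=> /eqP[/subr0_eq -> /subr0_eq ->].
Qed.

Lemma point_codeB : {in point_code &, forall x y, x - y \in point_code}.
Proof.
by move=> _ _ /imsetP[p _ ->] /imsetP[p' _ ->]; rewrite point_wordB mem_point_code.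
Qed.

Lemma point_codeP c :
  reflect (exists a b, c = point_word a b) (c \in point_code).
Proof.
apply: (iffP imsetP) => [[[a b] _ ->]|[a [b ->]]]; first by exists a, b.
by exists (a, b).
Qed.

Lemma point_code_weights (w : nat) :
  (exists c, [/\ c \in point_code, c != 0 & weight c = w]) <->
  (w = l - d \/ w = l)%N.
Proof.
split=> [[_ [/point_codeP[a [b ->]]]]|[] ->].
- rewrite point_word_eq0; have [->|a_neq0] := eqVneq a 0.
    have [->|/weight_point_word_const ->] := eqVneq b 0; first by rewrite eqxx.
    by move=> _ <-; right.
  by rewrite weight_point_word //; case: ifP; move=> _ _ <-; [left|right].
(* This function vanishes on the line through the point [o], so its weight is [l - d]; the constant
   1 below has weight [l]. *)
- exists (point_word 1 (- trace (1 * pt o))); split.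
  + exact: mem_point_code.
  + by rewrite point_word_eq0 xpair_eqE oner_eq0.
  + exact: weight_point_word_meet (oner_neq0 _).
exists (point_word 0 1); split; first exact: mem_point_code.
  by rewrite point_word_eq0 xpair_eqE oner_eq0 andbF.
exact: weight_point_word_const (oner_neq0 _).
Qed.

Lemma point_code_linear : linear_code point_code 3 (l - d).
Proof.
split.
  have [|x y|a x|V CV] := @set_vspace F l point_code.
  - by apply/imsetP; exists (0, 0) => //; apply/esym/eqP; rewrite point_word_eq0.
  - move=> xC yC; rewrite -[y]opprK point_codeB // -scaleN1r.
    by have /point_codeP[a [b ->]] := yC; rewrite point_wordZ mem_point_code.
  - by move=> /point_codeP[b [c ->]]; rewrite point_wordZ mem_point_code.
  (* The dimension is read off from the number q^3 of codewords. *)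
  exists V; split=> //; apply: (@expnI #|F|); first exact: finNzRing_gt1.
  rewrite -card_vspace -(eq_card CV) card_imset; last exact: point_word_inj.
  by rewrite card_prod cardE -expnSr.
apply: min_distance_weight; first exact: point_codeB.
  by apply/point_code_weights; left.
move=> c cC c_neq0.
have [] : (weight c = l - d \/ weight c = l)%N.
- by apply/point_code_weights; exists c.
- by move->.
- by move->; rewrite leq_subr.
Qed.

(** Sum over a first: a = 0 gives the zero word and q - 1 constants of weight [l]; each of the q^2 -
    1 other values of a gives l/d words of weight [l - d] and q - l/d of weight [l]. *)
Lemma point_code_enumerator (q : rat := #|F|%:R) :
  weight_enumerator point_code =
    1 + (((q ^+ 2 - 1) * l%:R) / d%:R) *: 'X^(l - d)
      + (((q ^+ 3 - 1) * d%:R - (q ^+ 2 - 1) * l%:R) / d%:R) *: 'X^l.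
Proof.
rewrite weight_enumeratorE big_imset /=; last by move=> p p' _ _; exact: point_word_inj.
rewrite (eq_bigl predT) // -(pair_bigA _ (fun a b => 'X^(weight (point_word a b)))) /=.
rewrite (bigD1 0) //= (bigD1 (0 : F)) //=.
have -> : weight (point_word 0 0) = 0%N.
  by apply: eq_card0 => i; rewrite !inE mxE mul0r tr0 addr0 eqxx.
under eq_bigr => b b_neq0 do rewrite weight_point_word_const //.
have d_neq0 : d%:R != 0 :> rat by rewrite Num.Theory.pnatr_eq0 -lt0n.
have sumb a : a != 0 -> \sum_b 'X^(weight (point_word a b)) =
    (l%:R / d%:R) *: 'X^(l - d) + (q - l%:R / d%:R) *: 'X^l :> {poly rat}.
  move=> a_neq0; set M := [set - trace (a * pt i) | i : 'I_l].
  have cardM : l%:R / d%:R = #|M|%:R :> rat.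
    by rewrite -(card_meeting_lines a_neq0) natrM mulfK.
  under eq_bigr => b _ do rewrite weight_point_word // -/M.
  rewrite (bigID [in M]) /=; congr (_ + _).
    rewrite (eq_bigr (fun=> 'X^(l - d))) => [|b -> //].
    by rewrite sumr_const cardM scaler_nat.
  rewrite (eq_bigr (fun=> 'X^l)) => [|b /negbTE -> //].
  rewrite sumr_const cardM -natrB ?max_card // scaler_nat; congr (_ *+ _).
  by rewrite -(cardC M) addKn.
rewrite (eq_bigr _ sumb) !sumr_const !cardC1 cardE.
have q_gt0 : (0 < #|F|)%N by exact: ltnW (finNzRing_gt1 F).
rewrite -!scaler_nat -!subn1 !natrB ?expn_gt0 ?q_gt0 // natrX -/q expr0.
rewrite scalerDr !scalerA -!addrA; congr (_ + _).
rewrite addrCA -scalerDl; congr (_ *: _ + _ *: _); first by rewrite mulrA.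
by field.
Qed.

Lemma dual_point_codeB : {in dual_code point_code &, forall x y,
  x - y \in dual_code point_code}.
Proof.
move=> x y; rewrite !inE => /'forall_implyP xC /'forall_implyP yC.
apply/'forall_implyP => c cC; under eq_bigr do rewrite !mxE mulrBr.
by rewrite sumrB (eqP (xC _ cC)) (eqP (yC _ cC)) subrr.
Qed.

(** Only the term at [i] survives in the inner product of [y] with this codeword. *)
Lemma dual_point_code_isolate a b (y : 'rV[F]_l) i :
    y \in dual_code point_code -> point_word a b 0 i != 0 ->
    (forall j, j != i -> y 0 j != 0 -> point_word a b 0 j = 0) ->
  y 0 i = 0.
Proof.
rewrite inE => /'forall_implyP/(_ _ (mem_point_code a b)) orth wi w0.
move: orth; rewrite (bigD1 i) //= big1 ?addr0 ?mulf_eq0 ?(negbTE wi) => [/eqP //|j ji].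
by have [->|/(w0 _ ji) ->] := eqVneq (y 0 j) 0; rewrite ?mulr0 ?mul0r.
Qed.

Lemma dual_point_code_weight_gt2 (y : 'rV[F]_l) :
  y \in dual_code point_code -> y != 0 -> (2 < weight y)%N.
Proof.
move=> yC y_neq0; rewrite ltnNge; apply/negP => wy.
have [i yi] : exists i, y 0 i != 0.
  by apply/existsP; apply: contra_neqT y_neq0 => /existsPn y0; apply/rowP=> i;
    rewrite mxE; apply/eqP; rewrite -[_ == _]negbK y0.
have iS : i \in [set i | y 0 i != 0] by rewrite inE.
move: wy; rewrite /weight (cardsD1 i) iS ltnS leq_eqVlt ltnS leqn0.
case/orP => [/cards1P[j Sj]|].
  have ij : pt i - pt j != 0.
    rewrite subr_eq0 (inj_eq pt_inj); apply/eqP => ij.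
    by have := set11 j; rewrite -Sj !inE ij eqxx.
  (* Nondegeneracy gives an affine function that vanishes at [j] but not at [i]. *)
  have [a] : exists a, trace (a * (pt i - pt j)) != 0.
    apply/existsP; apply: contraNT ij => /existsPn tr_0.
    apply/eqP/(trace_nondegenerate cardF cardE) => a.
    by apply/eqP; rewrite -[_ == _]negbK tr_0.
  rewrite mulrBr trD trN => tra; move/eqP: yi; apply.
  apply: (dual_point_code_isolate (a := a) (b := - trace (a * pt j)) yC).
    by rewrite mxE.
  move=> h hi yh; have : h \in [set j] by rewrite -Sj !inE hi.
  by rewrite inE => /eqP ->; rewrite mxE subrr.
rewrite cards_eq0 => /eqP S0; move/eqP: yi; apply.
apply: (dual_point_code_isolate (a := 0) (b := 1) yC).
  by rewrite mxE mul0r tr0 add0r oner_neq0.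
by move=> h hi yh; have := in_set0 h; rewrite -S0 !inE hi yh.
Qed.

Lemma dual_point_code_weight_gt3 (y : 'rV[F]_l) : d = 2 ->
  y \in dual_code point_code -> y != 0 -> (3 < weight y)%N.
Proof.
move=> d2 yC y_neq0; have := dual_point_code_weight_gt2 yC y_neq0.
rewrite leq_eqVlt => /predU1P[w3|//]; pose S := [set i | y 0 i != 0].
have [k kS] : exists k, k \in S by apply/set0Pn; rewrite -card_gt0 -[#|S|]w3.
move: w3; rewrite /weight -/S (cardsD1 k) kS => -[/esym/eqP/cards2P[i [j [ij Sij]]]].
have [iS jS] : i \in S :\ k /\ j \in S :\ k by rewrite Sij !inE !eqxx orbT.
have dij : pt i - pt j != 0 by rewrite subr_eq0 (inj_eq pt_inj).
(* With this multiplier a (pt i - pt j) = 1, which has trace 0; so [i] and [j] lie on one line of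
   direction [a], and d = 2 keeps [k] off it. *)
pose a := (pt i - pt j)^-1; have a_neq0 : a != 0 by rewrite invr_eq0.
have aij : trace (a * pt i) = trace (a * pt j).
  by apply/eqP; rewrite -subr_eq0 -trN -trD -mulrBr mulVf // (trace1 cardF cardE).
move: kS; rewrite inE => /eqP; case.
apply: (dual_point_code_isolate (a := a) (b := - trace (a * pt j)) yC).
  rewrite mxE subr_eq0; apply/negP => ak.
  have : ([set k; i; j] \subset [set h | trace (a * pt h) == trace (a * pt j)]).
    by rewrite !subUset !sub1set !inE ak aij eqxx.
  move/subset_leq_card; rewrite card_line // d2 leqNgt => /negP; apply.
  rewrite -setUA cardsU1 -Sij !inE eqxx /= Sij cards2 ij //.
move=> h hk yh; have : h \in S :\ k by rewrite !inE hk.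
by rewrite Sij !inE mxE => /orP[] /eqP ->; rewrite ?aij subrr.
Qed.

(* Pigeonhole: a word y is orthogonal to the code as soon as \sum_i y_i = 0 and
   \sum_i y_i pt_i = 0. *)
Lemma dual_point_code_exists (A : {set 'I_l}) (R : {set F * E}) :
    (forall f : {ffun 'I_l -> F}, f \in pffun_on 0 (mem A) predT ->
       (\sum_i f i, \sum_i f i *: pt i) \in R) ->
    (#|R| < #|F| ^ #|A|)%N ->
  exists y, [/\ y \in dual_code point_code, y != 0 & (weight y <= #|A|)%N].
Proof.
move=> gR ltRA; pose g (f : {ffun 'I_l -> F}) := (\sum_i f i, \sum_i f i *: pt i).
have : ~~ dinjectiveb g (pffun_on 0 (mem A) predT).
  apply: contraL ltRA => /dinjectiveP g_inj; rewrite -leqNgt.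
  rewrite -[X in (X <= _)%N](_ : #|pffun_on (0 : F) (mem A) predT| = _); last first.
    by rewrite card_pffun_on.
  rewrite -(card_in_image g_inj); apply/subset_leq_card/subsetP.
  by move=> _ /imageP[f /gR fR ->].
case/dinjectivePn=> f fA [f' /andP[f'f f'A] [sum_eq pt_eq]].
(* The word is the difference of two functions supported on [A] with the same pair of sums. *)
exists (\row_i (f i - f' i)); split.
- rewrite inE; apply/'forall_implyP => _ /point_codeP[a [b ->]].
  transitivity (trace (a * \sum_i (f i - f' i) *: pt i) + b * \sum_i (f i - f' i) == 0).
    rewrite mulr_sumr (big_morph _ trD tr0) mulr_sumr -big_split /=.
    congr (_ == 0); apply: eq_bigr => i _; rewrite !mxE -scalerAr trZ mulrDl.
    by rewrite [_ * trace _]mulrC.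
  rewrite sumrB sum_eq subrr mulr0 addr0.
  under eq_bigr do rewrite scalerBl.
  by rewrite sumrB pt_eq subrr mulr0 tr0 eqxx.
- apply: contraNneq f'f => /rowP ff'; apply/eqP/ffunP => i.
  by have /eqP := ff' i; rewrite !mxE subr_eq0 eq_sym => /eqP.
apply/subset_leq_card/subsetP=> i; rewrite inE mxE; apply: contraNT => iA.
have outA (h : {ffun 'I_l -> F}) : h \in pffun_on 0 (mem A) predT -> h i = 0.
  by move=> /pffun_onP[/supportP/(_ i iA)].
by rewrite !outA // subrr.
Qed.

(** Three points are taken on the line of trace 0 through the origin. Their combinations stay in
    that line, which has q points, so only q^2 pairs of sums face q^3 functions. *)
Lemma dual_point_code_distance3 :
  (2 < d)%N -> min_distance (dual_code point_code) 3.
Proof.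
move=> d_gt2; have := d_gt2; rewrite -(card_line o (oner_neq0 E)).
case/exists_subset_card => A /subsetP Aline cardA.
have Atr i : i \in A -> trace (pt i) = 0.
  by move=> /Aline; rewrite inE !mul1r pt_o tr0 => /eqP.
pose K := [set x : E | x ^+ #|F| == x].
have cardK : #|K| = #|F|.
  by apply: card_fix_frobenius cardE _; rewrite cardF (ext_pchar_pow2 L cardF).
have [||y [yC y_neq0 wy]] := @dual_point_code_exists A (setX setT K).
- move=> f /pffun_onP[/supportP fA _]; rewrite !inE /=.
  rewrite -tr_eq0 ?(trace_ext_pchar2 L cardF) // -(trace_tr cardE).
  rewrite (big_morph _ trD tr0) big1 ?scale0r // => i _; rewrite trZ.
  by have [/Atr ->|/fA ->] := boolP (i \in A); rewrite ?mulr0 ?mul0r.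
- by rewrite cardsX cardsT cardK cardA mulnn ltn_exp2l ?finNzRing_gt1.
apply: min_distance_weight; first exact: dual_point_codeB.
  exists y; split=> //; apply/eqP.
  by rewrite eqn_leq -{1}cardA wy dual_point_code_weight_gt2.
by move=> c; exact: dual_point_code_weight_gt2.
Qed.

(** For any four points, q^4 functions face only q^3 pairs of sums. *)
Lemma dual_point_code_distance4 :
  d = 2 -> (3 < l)%N -> min_distance (dual_code point_code) 4.
Proof.
move=> d2; rewrite -{1}[l]card_ord -cardsT.
case/exists_subset_card => A _ cardA.
have [||y [yC y_neq0 wy]] := @dual_point_code_exists A setT.
- by move=> f _; rewrite inE.
- by rewrite cardsT card_prod cardE cardA -expnS ltn_exp2l ?finNzRing_gt1.
apply: min_distance_weight; first exact: dual_point_codeB.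
  exists y; split=> //; apply/eqP.
  by rewrite eqn_leq -{1}cardA wy dual_point_code_weight_gt3.
by move=> c; exact: dual_point_code_weight_gt3.
Qed.

End PointCode.

(** * The extended trace code as a code on the roots of x^(n+1) = x *)

Section RootsOfUnityCode.

Variables (e n : nat) (F : finFieldType) (L : fieldExtType F).
Local Notation E := (finvect_type L).
Hypotheses (cardF : #|F| = (2 ^ e)%N) (cardE : #|E| = (#|F| ^ 2)%N).
Variable beta : E.
Hypotheses (beta_prim : n.-primitive_root beta) (n_odd : odd n) (n_gt1 : (1 < n)%N).

(* The parity coordinate of the extended code is the value at the point 0. *)
Definition root_point (i : 'I_(n + 1)) : E :=
  if split i is inl j then beta ^+ (j : 'I_n) else 0.

Lemma root_point_lshift (j : 'I_n) : root_point (lshift 1 j) = beta ^+ j.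
Proof. by rewrite /root_point (unsplitK (inl j)). Qed.

Lemma root_point_rshift (j : 'I_1) : root_point (rshift n j) = 0.
Proof. by rewrite /root_point (unsplitK (inr j)). Qed.

Let beta_neq0 : beta != 0.
Proof.
apply: contra_eq_neq (prim_expr_order beta_prim) => ->.
by rewrite expr0n gtn_eqF ?(ltnW n_gt1) // eq_sym oner_neq0.
Qed.

Lemma root_point_inj : injective root_point.
Proof.
move=> i i'; case: (split_ordP i) => j ->; case: (split_ordP i') => j' ->;
  rewrite ?root_point_lshift ?root_point_rshift.
- move/eqP; rewrite (eq_prim_root_expr beta_prim) !modn_small // => /eqP jj'.
  by congr lshift; apply: val_inj.
- by move/eqP; rewrite expf_eq0 (negbTE beta_neq0) andbF.
- by move/esym/eqP; rewrite expf_eq0 (negbTE beta_neq0) andbF.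
by rewrite !ord1.
Qed.

Lemma root_point_image : root_point @: 'I_(n + 1) = [set x | x ^+ (n + 1) == x].
Proof.
apply/eqP; rewrite eqEcard; apply/andP; split; last first.
  by rewrite (card_imset _ root_point_inj) card_ord addn1 (card_expr_fix beta_prim).
apply/subsetP=> _ /imsetP[i _ ->]; rewrite inE; case: (split_ordP i) => j ->.
  rewrite root_point_lshift addn1 exprS [X in _ * X]exprAC.
  by rewrite (prim_expr_order beta_prim) expr1n mulr1.
by rewrite root_point_rshift expr0n addn1.
Qed.

Lemma extended_augmented_trace_code :
  extended_code (augmented_trace_code n beta) = point_code root_point.
Proof.
have F2 := trace_base_pchar2 cardF.
have sum_beta : \sum_(i < n) beta ^+ i = 0.
  have : beta - 1 != 0.
    rewrite subr_eq0; apply: contraTneq n_gt1 => beta1.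
    have := prim_order_dvd beta_prim 1; rewrite beta1 expr1n eqxx dvdn1.
    by move/eqP=> ->.
  move/mulfI; apply.
  by rewrite mulr0 -subrX1 (prim_expr_order beta_prim) subrr.
have extE a b : extend_word (trace_word n beta a + b *: const_mx 1) =
    point_word root_point a b.
  apply/rowP=> i; rewrite [RHS]mxE; case: (split_ordP i) => j ->.
    by rewrite row_mxEl !mxE mulr1 root_point_lshift.
  (* The powers of [beta] sum to 0, so the parity coordinate is -n b, which equals b since n is odd
     and the characteristic is 2. *)
  rewrite row_mxEr !mxE root_point_rshift.
  under eq_bigr do rewrite !mxE mulr1.
  have tr0 : trace (0 : E) = 0 by rewrite -(scale0r 0) traceZ // mul0r.
  rewrite big_split /= -(big_morph _ (traceD cardF cardE) tr0) -mulr_sumr sum_beta.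
  rewrite mulr0 tr0 !add0r sumr_const card_ord oppr_pchar2 //.
  by rewrite -(odd_double_half n) n_odd mulrS -mul2n mulrnA mulr2n addrr_pchar2 //
    mul0rn addr0.
apply/setP=> c; apply/imsetP/point_codeP => [[_ /imset2P[a b _ _ ->] ->]|[a [b ->]]].
  by exists a, b.
exists (trace_word n beta a + b *: const_mx 1); last by rewrite extE.
by apply/imset2P; exists a b.
Qed.

End RootsOfUnityCode.

(** * Arithmetic of the parameters, and transfer of the line counts to the code *)

Theorem theorem6 (m k q d n N r : nat) (F : finFieldType) (L : fieldExtType F)
    (alpha : {unit finvect_type L}) (beta : finvect_type L)
    (Cbar : {set 'rV[F]_(n + 1)})
    (hm : (1 <= m)%N) (hk : (1 <= k)%N)
    (hq : q = (2 ^ (k * m))%N) (hd : d = (2 ^ m)%N)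
    (hn : n = ((q + 1) * (d - 1))%N) (hN : N = ((q - 1) %/ (d - 1))%N)
    (hr : r = (q ^ 2)%N)
    (hF : #|F| = q) (hL : #|finvect_type L| = r)
    (halpha : generator [set: {unit finvect_type L}] alpha)
    (hbeta : beta = FinRing.uval alpha ^+ N)
    (hCbar : Cbar = extended_code (augmented_trace_code n beta)) :
  [/\ linear_code Cbar 3 (n + 1 - d),
      forall w : nat,
        (exists c, [/\ c \in Cbar, c != 0 & weight c = w]) <->
        (w = n + 1 - d \/ w = n + 1)%N,
      weight_enumerator Cbar =
        1 + (((q%:R ^+ 2 - 1) * (n%:R + 1)) / d%:R) *: 'X^(n + 1 - d)
          + (((q%:R ^+ 3 - 1) * d%:R - (q%:R ^+ 2 - 1) * (n%:R + 1)) / d%:R)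
              *: 'X^(n + 1),
      (1 < m)%N -> min_distance (dual_code Cbar) 3
    & m = 1%N -> min_distance (dual_code Cbar) 4].
Proof.
have cardF : #|F| = (2 ^ (k * m))%N by rewrite hF.
have cardE : #|finvect_type L| = (#|F| ^ 2)%N by rewrite hL hF.
have d_gt1 : (1 < d)%N by rewrite hd -{1}(expn0 2) ltn_exp2l.
have q_gt1 : (1 < q)%N by rewrite -hF finNzRing_gt1.
have dvd_dq : (d.-1 %| q.-1)%N by rewrite hq mulnC expnM -hd dvdn_pred_predX.
have NE : (N * (d - 1) = q - 1)%N by rewrite hN divnK // !subn1.
have n_gt0 : (0 < n)%N by rewrite hn muln_gt0 addn1 subn_gt0.
(* Since N (d - 1) = q - 1, N n = (q - 1)(q + 1) is the order of [alpha]; hence [beta] has order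
   [n]. *)
have nNE : (#|finvect_type L|.-1 = N * n)%N.
  by rewrite hn mulnCA NE mulnC -subn_sqr exp1n cardE hF subn1.
have beta_prim : n.-primitive_root beta.
  have := dvdn_prim_root (generator_prim_root halpha) (m := n).
  by rewrite nNE dvdn_mull // mulnK // -hbeta; apply.
have n_gt1 : (1 < n)%N.
  by rewrite hn -[2%N]muln1 leq_mul ?subn_gt0 // addn1 ltnS ltnW.
have n_odd : odd n.
  rewrite hn oddM oddB ?(ltnW d_gt1) // oddD hq hd !oddX.
  by rewrite !gtn_eqF ?muln_gt0 ?hk.
have d_lt : (d < n + 1)%N.
  rewrite addn1 ltnS hn -{1}(subnK (ltnW d_gt1)) mulnDl mul1n addnC leq_add2r.
  by rewrite muln_gt0 subn_gt0 d_gt1 ltnW.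
pose o : 'I_(n + 1) := rshift n ord0.
pose pt : 'I_(n + 1) -> finvect_type L := root_point beta.
have pt_o : pt o = 0 by exact: root_point_rshift.
have pt_inj : injective pt := root_point_inj beta_prim n_gt1.
have card_line (a : finvect_type L) (i0 : 'I_(n + 1)) : a != 0 ->
    #|[set i | trace (a * pt i) == trace (a * pt i0)]| = d.
  (* Indices are traded for the points of the arc, which [root_point] enumerates bijectively. *)
  move=> a_neq0;
  rewrite -[LHS](card_imset _ pt_inj)
    -[RHS](@card_line_arc _ #|F| d (trace_ext_pchar2 L cardF) cardE _ _ d_gt1 _
    a (tr #|F| (a * pt i0)) (pt i0) a_neq0) //.
  - rewrite hF -hn; apply: eq_card => x; apply/imsetP/idP => [[i]|].
      rewrite !inE trace_eq // hF => tri ->; rewrite tri andbT.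
      have : pt i \in pt @: 'I_(n + 1) by rewrite imset_f.
      by rewrite (root_point_image beta_prim) // inE.
    rewrite inE => /andP[xS trx].
    have : x \in pt @: 'I_(n + 1).
      by rewrite (root_point_image beta_prim) // inE.
    by case/imsetP=> i _ xi; exists i; rewrite // inE trace_eq // hF -xi.
  - by rewrite cardF (ext_pchar_pow2 L cardF).
  - by rewrite hd (ext_pchar_pow2 L cardF).
  - by rewrite hF.
  - have : pt i0 \in pt @: 'I_(n + 1) by rewrite imset_f.
    by rewrite (root_point_image beta_prim) // inE hF -hn => /eqP.
rewrite hCbar (extended_augmented_trace_code cardF cardE beta_prim n_odd n_gt1).
split.
- exact: (point_code_linear cardF cardE o d_lt card_line).
- exact: (point_code_weights cardE o d_lt card_line).
- rewrite (point_code_enumerator cardF cardE o d_lt card_line).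
  by rewrite hF natrD.
- move=> m_gt1; apply: (dual_point_code_distance3 cardF cardE pt_inj pt_o card_line).
  by rewrite hd -{1}(expn1 2) ltn_exp2l.
move=> m1; apply: (dual_point_code_distance4 cardF cardE pt_inj card_line).
  by rewrite hd m1.
(* For d = 2 the length n + 1 is q + 2, hence at least 4. *)
by rewrite addn1 ltnS hn hd m1 muln1 addn1 ltnS.
Qed.
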